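(* Let $n\ge 1$. There are exactly $2^{n-1}$ different maps $\varphi_{\vec{c}}$, where $\vec{c}$ ranges over the vectors in $\{-1,1\}^n$ with $c_1=1$. The set $\Psi_n$ of all these maps $\varphi_{\vec{c}}$ forms an abelian group under composition of maps, and this group is isomorphic to the group $(\mathbb{Z}_2^{\,n-1},+)$.
   Context: $M_{n,n}(\mathbb{R})$ is the set of real $n\times n$ matrices. For $\vec{c}=(c_1,\ldots,c_n)\in\{-1,1\}^n$ with $c_1=1$, the map $\varphi_{\vec{c}}:M_{n,n}(\mathbb{R})\to M_{n,n}(\mathbb{R})$ is defined by $(\varphi_{\vec{c}}(A))_{ij}=c_i\,a_{ij}\,c_j$ for $A=(a_{ij})$. *)

(* Defs.v *)
(* MathComp / MathComp-Analysis *)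
From mathcomp Require Import all_boot all_order all_algebra.
From mathcomp Require Import boolp classical_sets functions cardinality reals.

Set Implicit Arguments.
Unset Strict Implicit.
Unset Printing Implicit Defensive.

Import Order.TTheory GRing.Theory Num.Theory.
Local Open Scope classical_set_scope.
Local Open Scope ring_scope.

(* Indices run over {0, ..., n - 1}, so the condition c_1 = 1 bears on the
   index [Ordinal n_gt0], whose value is 0. *)
Definition sign_vectors (R : realType) (n : nat) (n_gt0 : (0 < n)%N) :
    set 'rV[R]_n :=
  [set c | (forall i, c 0 i = -1 \/ c 0 i = 1) /\ c 0 (Ordinal n_gt0) = 1].
Arguments sign_vectors R {n} n_gt0.

Definition phi (R : realType) (n : nat) (c : 'rV[R]_n) (A : 'M[R]_n) :
    'M[R]_n :=
  \matrix_(i, j) (c 0 i * A i j * c 0 j).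

Definition Psi (R : realType) (n : nat) (n_gt0 : (0 < n)%N) :
    set ('M[R]_n -> 'M[R]_n) :=
  [set phi c | c in sign_vectors R n_gt0].
Arguments Psi R {n} n_gt0.

(* MathComp's [groupType] structures a whole type, whereas here the group is
   a subset [G] of a function type, with an operation defined on that type. *)
Record abelian_group_on (T : Type) (G : set T) (op : T -> T -> T) : Prop := {
  abelian_group_closed : forall x y, G x -> G y -> G (op x y);
  abelian_group_assoc : forall x y z, G x -> G y -> G z ->
    op x (op y z) = op (op x y) z;
  abelian_group_unit_inv : exists2 e, G e &
    (forall x, G x -> op e x = x /\ op x e = x) /\
    (forall x, G x -> exists2 y, G y & op y x = e /\ op x y = e);
  abelian_group_comm : forall x y, G x -> G y -> op x y = op y x
}.

Definition isomorphic_groups (T U : Type) (G : set T) (opG : T -> T -> T)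
    (H : set U) (opH : U -> U -> U) : Prop :=
  exists2 f : T -> U, set_bij G H f &
    forall x y, G x -> G y -> f (opG x y) = opH (f x) (f y).

(* Main.v *)
(* A vector v of (Z/2)^(n-1) yields the sign vector (1, (-1)^(v_1), ...,
   (-1)^(v_(n-1))), and every admissible c arises this way. Composing maps phi
   multiplies their sign vectors entrywise, so v |-> phi is a morphism from
   (Z/2)^(n-1) onto Psi. It is injective because the first row of the image of
   the all-ones matrix under phi_c is c. *)
Require Import Defs.
From mathcomp Require Import all_boot all_order all_algebra.
From mathcomp Require Import boolp classical_sets functions cardinality reals.

Import Order.TTheory GRing.Theory Num.Theory.
Local Open Scope classical_set_scope.
Local Open Scope card_scope.
Local Open Scope ring_scope.

(** Each law on the image is the image under [g] of the same law in [V]. The laws are checked on the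
    range only, since [op] (composition, later) need not be commutative or have inverses on all of
    [T]. *)
Lemma abelian_group_on_range (V : zmodType) (T : Type) (op : T -> T -> T)
    (g : V -> T) :
  {morph g : u v / u + v >-> op u v} -> abelian_group_on (range g) op.
Proof.
move=> gD; split.
- by move=> _ _ [u _ <-] [v _ <-]; exists (u + v).
- by move=> _ _ _ [u _ <-] [v _ <-] [w _ <-]; rewrite -!gD addrA.
- exists (g 0); first by exists 0.
  split=> _ [u _ <-]; first by rewrite -!gD add0r addr0.
  by exists (g (- u)); [exists (- u) | rewrite -!gD addNr addrN].
- by move=> _ _ [u _ <-] [v _ <-]; rewrite -!gD addrC.
Qed.

Lemma isomorphic_groups_range (V : zmodType) (T : Type) (op : T -> T -> T)
    (g : V -> T) :
  injective g -> {morph g : u v / u + v >-> op u v} ->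
  isomorphic_groups (range g) op [set: V] +%R.
Proof.
(* The isomorphism must leave the range, so it is the inverse of [g]: [f] chooses a preimage, and
   its default 0 is taken only outside the range. *)
move=> g_inj gD; pose f x := xget 0 [set v | g v = x].
have gK : cancel g f.
  by move=> v; apply: g_inj; apply: (xgetPex 0 (P := [set u | g u = g v])); exists v.
exists f; last by move=> _ _ [u _ <-] [v _ <-]; rewrite -gD !gK.
split=> //.
- by move=> _ _ /set_mem[u _ <-] /set_mem[v _ <-]; rewrite !gK => ->.
- by move=> v _; exists (g v); [exists v | rewrite gK].
Qed.

Lemma card_eq_range_finType (T : finType) (U : Type) (g : T -> U) :
  injective g -> range g #= `I_#|T|.
Proof.
move=> g_inj; pose h (x : T) : nat := enum_rank x.
(* With the initial segment written as the image of the enumeration [h], both sides are injective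
   images of [T]. *)
have <- : range h = `I_#|T|.
  apply/seteqP; split=> [_ [x _ <-]|k /= k_lt]; first exact: ltn_ord.
  by exists (enum_val (Ordinal k_lt)); rewrite // /h enum_valK.
have h_inj : injective h by move=> x y /val_inj /enum_rank_inj.
apply: (card_eq_trans (B := [set: T])); last rewrite card_eq_sym.
  by apply: inj_card_eq => x y _ _; apply: g_inj.
by apply: inj_card_eq => x y _ _; apply: h_inj.
Qed.

Section SignVectors.
Variables (R : realType) (m : nat).
Implicit Types (c d : 'rV[R]_m.+1) (v w : 'rV['Z_2]_m).

Lemma phi_comp c d : phi c \o phi d = phi (\row_i (c 0 i * d 0 i)).
Proof.
apply/funext => A; apply/matrixP => i j.
by rewrite /= /phi !mxE -!mulrA [d 0 j * c 0 j]mulrC.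
Qed.

Lemma phi_inj c d : c 0 ord0 = 1 -> d 0 ord0 = 1 -> phi c = phi d -> c = d.
Proof.
move=> c1 d1 /(congr1 (fun f => f (const_mx 1))) /matrixP eq_cd.
apply/rowP => i.
by have := eq_cd ord0 i; rewrite /phi !mxE c1 d1 !mul1r.
Qed.

(** [unlift ord0] gives [None] only at index 0, so the default 1 of [oapp] is the normalisation of
    the first sign. *)
Definition sign_row v : 'rV[R]_m.+1 :=
  \row_i oapp (fun j => (-1) ^+ (v 0 j : nat)) 1 (unlift ord0 i).

Lemma sign_row0 v : sign_row v 0 ord0 = 1.
Proof. by rewrite mxE unlift_none. Qed.

Lemma sign_row_lift v j :
  sign_row v 0 (lift ord0 j) = (-1) ^+ (v 0 j : nat).
Proof. by rewrite mxE liftK. Qed.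

Lemma sign_rowD v w :
  sign_row (v + w) = \row_i (sign_row v 0 i * sign_row w 0 i).
Proof.
apply/rowP => i; rewrite !mxE; case: unliftP => [j _|_] /=; last by rewrite mulr1.
(* Addition in ['Z_2] reduces the sum of the exponents modulo 2, and a power of -1 depends only on
   the parity of its exponent. *)
by rewrite mxE -exprD -[RHS]signr_odd /= modn2.
Qed.

Lemma sign_row_inj : injective sign_row.
Proof.
move=> v w /rowP eq_vw; apply/rowP => j.
have := eq_vw (lift ord0 j); rewrite !sign_row_lift => /eqP.
rewrite -signr_odd -[X in _ == X]signr_odd => /eqP/signr_inj.
(* The representatives in ['Z_2] are 0 and 1, so equal parity means equality. *)
by case: (v 0 j) (w 0 j) => [[|[|//]] ?] [[|[|//]] ?] //= _; apply: val_inj.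
Qed.

Lemma range_sign_row (n_gt0 : (0 < m.+1)%N) :
  range sign_row = sign_vectors R n_gt0.
Proof.
rewrite /sign_vectors (_ : Ordinal n_gt0 = ord0); last exact: val_inj.
apply/seteqP; split=> [_ [v _ <-]|c [c_sign c1]] /=.
  split; last exact: sign_row0.
  move=> i; rewrite mxE; case: unliftP => [j _|_] /=; last by right.
  by rewrite -signr_odd; case: odd; [left | right].
(* The exponent is 1 exactly where the sign is -1. *)
exists (\row_j (c 0 (lift ord0 j) == -1)%:R) => //.
apply/rowP => i; rewrite mxE; case: unliftP => [j ->|->] //=.
rewrite mxE; have [-> //|/eqP cN1] := eqVneq (c 0 (lift ord0 j)) (-1).
by have [//|->] := c_sign (lift ord0 j).
Qed.

Lemma phi_sign_row_inj : injective (@phi R m.+1 \o sign_row).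
Proof.
by move=> v w /(phi_inj _ _ (sign_row0 v) (sign_row0 w)) /sign_row_inj.
Qed.

Lemma phi_sign_rowD :
  {morph @phi R m.+1 \o sign_row : v w / v + w >-> v \o w}.
Proof. by move=> v w; rewrite /= sign_rowD phi_comp. Qed.

Lemma Psi_range (n_gt0 : (0 < m.+1)%N) :
  Psi R n_gt0 = range (@phi R m.+1 \o sign_row).
Proof. by rewrite /Psi -(range_sign_row n_gt0) image_comp. Qed.

End SignVectors.

Theorem theorem5 (R : realType) (n : nat) (n_gt0 : (0 < n)%N) :
  [/\ Psi R n_gt0 #= `I_(2 ^ n.-1),
      abelian_group_on (Psi R n_gt0) (fun f g => f \o g) &
      isomorphic_groups (Psi R n_gt0) (fun f g => f \o g)
        [set: 'rV['Z_2]_(n.-1)] +%R].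
Proof.
case: n n_gt0 => [//|m] n_gt0; rewrite Psi_range /=; split.
- have := card_eq_range_finType _ _ _ (phi_sign_row_inj R m).
  (* ['rV['Z_2]_m] has 2 ^ (1 * m) elements. *)
  by rewrite card_mx card_ord mul1n.
- exact: abelian_group_on_range _ _ _ _ (phi_sign_rowD R m).
- exact: isomorphic_groups_range _ _ _ _ (phi_sign_row_inj R m) (phi_sign_rowD R m).
Qed.
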